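(* Let $\gamma\ge 1$ be an integer, $d\ge 1$, and let $\mathbf n=(n_1,\dots,n_d)$ be a $d$-tuple of non-negative integers. Let $\psi:\mathbb D^d\to\mathbb C$ be a non-zero analytic function, and let $\varphi:\mathbb D^d\to\mathbb D^d$ be an analytic self-map of the form $\varphi(z_1,\dots,z_d)=(\varphi_1(z_1),\dots,\varphi_d(z_d))$ such that $D_{\mathbf n,\psi,\varphi}$ is bounded on $\mathcal H_\gamma(\mathbb D^d)$. Then $D_{\mathbf n,\psi,\varphi}$ is complex symmetric with respect to the conjugation $\mathcal J$ if and only if $$\psi(z_1,\dots,z_d)=a\prod_{j=1}^d z_j^{n_j}\bigl(1-z_j\varphi_j(0)\bigr)^{-\gamma-n_j}$$ and $$\varphi_t(z_t)=\varphi_t(0)+\bigl(1-z_t\varphi_t(0)\bigr)^{-1}z_t\varphi_t'(0)\quad\text{for } t=1,\dots,d,$$ where $a=\partial^{\mathbf n}\psi(0,\dots,0)=\dfrac{\partial^{n_1+\cdots+n_d}\psi}{\partial z_1^{n_1}\cdots\partial z_d^{n_d}}(0,\dots,0)$.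
   Context: $\mathbb D$ is the open unit disk in $\mathbb C$ and $\mathbb D^d$ the polydisk. For a positive integer $\gamma$, $\mathcal H_\gamma(\mathbb D^d)$ is the reproducing kernel Hilbert space of holomorphic functions on $\mathbb D^d$ with kernel $K_w(z)=\prod_{j=1}^d(1-\overline{w_j}z_j)^{-\gamma}$. The weighted composition-differentiation operator is $D_{\mathbf n,\psi,\varphi}f(z)=\psi(z)\,(\partial^{\mathbf n}f)(\varphi(z))$, where $\partial^{\mathbf n}=\frac{\partial^{n_1+\cdots+n_d}}{\partial z_1^{n_1}\cdots\partial z_d^{n_d}}$. A conjugation on a Hilbert space is an anti-linear, isometric, involutive map $\mathcal C$; a bounded operator $T$ is complex symmetric with respect to $\mathcal C$ if $T=\mathcal C T^*\mathcal C$. $\mathcal J$ is the conjugation $\mathcal Jf(z)=\overline{f(\overline z)}$, where $\overline z=(\overline{z_1},\dots,\overline{z_d})$.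
   Formalization: The constant is taken as a = ∂^n ψ(0)/(n_1!⋯n_d!) instead of a = ∂^n ψ(0); the printed value fails when some n_j ≥ 2 (d=1, γ=1, n=2, ψ(z)=z², φ(z)=z/2 is J-symmetric, yet would force ψ=2z²), and both agree when all n_j ≤ 1. *)

(* Defs.v *)
From HB Require Import structures.
From mathcomp Require Import all_boot all_order all_algebra sesquilinear.
From mathcomp Require Import complex.
From mathcomp Require Import all_classical all_reals all_analysis.

Set Implicit Arguments.
Unset Strict Implicit.
Unset Printing Implicit Defensive.

Import Order.TTheory GRing.Theory Num.Theory.
Import numFieldNormedType.Exports.

Local Open Scope classical_set_scope.
Local Open Scope ring_scope.

(* R[i] itself carries no canonical topology: it gets one, together with the
   structure of a normed module over itself, when seen as a numClosedFieldType.
   Norms are then elements of the field, compared with its partial order, and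
   [differentiable], ['D_v f], [derive1] are complex differentiability and
   complex derivatives. *)
Definition Cplx (R : realType) : numClosedFieldType := R[i]%C.

Section Operators.
Variables (R : realType) (H : completeNormedModType (Cplx R)).
Implicit Types (dot : {dot H for Num.conj}) (T S C : H -> H).

Definition bounded_operator T :=
  exists M : Cplx R, forall f, `|T f| <= M * `|f|.

Definition adjoint dot T S := forall f g, dot (T f) g = dot f (S g).

Definition conjugation C :=
  [/\ forall (a : Cplx R) f g, C (a *: f + g) = a^* *: C f + C g,
      forall f, `|C f| = `|f| &
      involutive C].

(* [T = C T^* C]; the adjoint of [T] is unique when it exists, and it exists
   when [T] is linear and bounded. *)
Definition complex_symmetric dot C T :=
  conjugation C /\
  exists S, adjoint dot T S /\ forall f, T f = C (S (C f)).

End Operators.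

(* A Hilbert space of functions on [X] with reproducing kernel [K], where
   [K w z] stands for K_w(z). Points of the space are identified with functions
   on [X] by [rk_eval]; values of [rk_eval f] outside [X] are irrelevant. By the
   Moore-Aronszajn theorem, [K] determines the space up to an isometry
   compatible with [rk_eval]. *)
Record rkhs (R : realType) (P : Type) (X : set P) (K : P -> P -> Cplx R) := {
  rk_space :> completeNormedModType (Cplx R) ;
  rk_dot : {dot rk_space for Num.conj} ;
  rk_norm : forall f : rk_space, `|f| ^+ 2 = rk_dot f f ;
  rk_eval : rk_space -> P -> Cplx R ;
  rk_eval_linear : forall (a : Cplx R) (f g : rk_space) z, X z ->
    rk_eval (a *: f + g) z = a * rk_eval f z + rk_eval g z ;
  rk_eval_inj : forall f g : rk_space,
    (forall z, X z -> rk_eval f z = rk_eval g z) -> f = g ;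
  rk_ker : P -> rk_space ;
  rk_kerE : forall w z, X w -> X z -> rk_eval (rk_ker w) z = K w z ;
  rk_reproducing : forall (f : rk_space) w, X w ->
    rk_eval f w = rk_dot f (rk_ker w)
}.

Section Polydisk.
Variables (R : realType) (d : nat).
Local Notation C := (Cplx R).
Local Notation Cd := 'rV[C]_d.

Definition disk : set C := [set z | `|z| < 1].

Definition polydisk : set Cd := [set z | forall j, disk (z ord0 j)].

Definition holomorphic (V : normedModType C) (f : Cd -> V) :=
  forall z, polydisk z -> differentiable f z.

Definition kernel (gamma : nat) (w z : Cd) : C :=
  \prod_(j < d) (1 - (w ord0 j)^* * z ord0 j) ^- gamma.

Record Hspace (gamma : nat) := {
  Hspace_rkhs :> rkhs polydisk (kernel gamma) ;
  Hspace_holomorphic : forall f : Hspace_rkhs, holomorphic (rk_eval f)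
}.

Definition partial (j : 'I_d) (f : Cd -> C) : Cd -> C :=
  fun z => 'D_(delta_mx ord0 j) f z.

Definition mpartial (n : 'I_d -> nat) (f : Cd -> C) : Cd -> C :=
  foldr (fun j g => iter (n j) (partial j) g) f (enum 'I_d).

Definition comp_diff (n : 'I_d -> nat) (psi : Cd -> C) (Phi : Cd -> Cd)
    (f : Cd -> C) : Cd -> C :=
  fun z => psi z * mpartial n f (Phi z).

Definition prod_map (phi : 'I_d -> C -> C) (z : Cd) : Cd :=
  \row_j phi j (z ord0 j).

Definition conj_fun (f : Cd -> C) : Cd -> C :=
  fun z => (f (map_mx Num.conj z))^*.

Variables (gamma : nat) (H : Hspace gamma).

(* The function [F (rk_eval f)] belongs to the space and is represented there
   by [T f]. *)
Definition realizes (T : H -> H) (F : (Cd -> C) -> (Cd -> C)) :=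
  forall (f : H) z, polydisk z -> rk_eval (T f) z = F (rk_eval f) z.

(* The element of the space whose function is [conj_fun (rk_eval f)]. It always
   exists, because kernel(conj w, conj z) is the conjugate of kernel(w, z), and
   it is unique by [rk_eval_inj]; the default value 0 makes the definition
   possible before this is proved. *)
Definition J (f : H) : H :=
  xget 0 [set g : H | forall z, polydisk z ->
    rk_eval g z = conj_fun (rk_eval f) z].

End Polydisk.

Arguments disk {R}.
Arguments polydisk {R d}.
Arguments J {R d gamma}.

(* Main.v *)
(* The reproducing kernels span a dense subspace, so complex symmetry of D with
   respect to J amounts to (D K_w)(conj u) = (D K_u)(conj w) for all w and u,
   that is, to the symmetry in x and y of
     psi(x) prod_j y_j^n_j (1 - y_j phi_j(x_j))^-(gamma + n_j).
   The two formulas make this expression symmetric.  Conversely, dividing the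
   symmetry relation by prod_j y_j^n_j and letting y tend to 0 along the diagonal
   determines psi up to a constant; the relation then decouples into
     ((1 - x phi_t(0)) (1 - y phi_t(x)))^m = ((1 - y phi_t(0)) (1 - x phi_t(y)))^m,
   with m = gamma + n_t > 0, whose derivative in y at 0 is the formula for phi_t. *)

Require Import Defs.
From mathcomp Require Import all_boot all_order all_algebra sesquilinear.
From mathcomp Require Import complex.
From mathcomp Require Import all_classical all_reals all_analysis.
From mathcomp Require Import ring.

Import Order.TTheory GRing.Theory Num.Theory.
Import numFieldNormedType.Exports.

Local Open Scope classical_set_scope.
Local Open Scope ring_scope.

(** * Archimedean estimates and null sequences over the complex scalars *)

Section cplx.
Context {R : realType}.
Local Notation C := (Cplx R).

(** A positive element of [C] is real, so the Archimedean property of [R] applies to its real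
    part. *)
Lemma Cplx_natSinv_lt (e : C) : 0 < e ->
  \forall k \near \oo, (k.+1%:R : C)^-1 < e.
Proof.
move=> e0.
have re : e = (complex.Re e)%:C%C by rewrite RRe_real // gtr0_real.
have e0' : 0 < complex.Re e by move: e0; rewrite {1}re ltcR.
have [N _ HN] := near_infty_natSinv_lt (PosNum e0').
exists N => // k /= /HN /= hk.
rewrite re.
suff -> : (k.+1%:R : C)^-1 = ((k.+1%:R : R)^-1)%:C%C by rewrite ltcR.
by rewrite fmorphV rmorph_nat.
Qed.

Lemma Cplx_cvg0 (V : normedModType C) (u : nat -> V) (c : C) : 0 <= c ->
  (forall k, `|u k| ^+ 2 <= c / k.+1%:R) -> u @ \oo --> (0 : V).
Proof.
move=> c0 hu; apply/cvgr0Pnorm_lt => e e0.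
(* [c] may be 0, so the division is by [c + 1]. *)
have c1 : 0 < c + 1 by rewrite ltr_wpDl.
have e2 : 0 < e ^+ 2 / (c + 1) by rewrite divr_gt0 // exprn_gt0.
near=> k.
rewrite -(@ltr_pXn2r _ 2) ?nnegrE ?(ltW e0) //.
apply: (le_lt_trans (hu k)).
apply: (@le_lt_trans _ _ ((c + 1) / k.+1%:R)).
  by rewrite ler_wpM2r ?invr_ge0 // lerDl.
rewrite mulrC -ltr_pdivlMr //.
near: k; exact: Cplx_natSinv_lt.
Unshelve. all: by end_near.
Qed.

End cplx.

(** * Hilbert space geometry and density of the span of the reproducing kernels *)

Section rkhs.
Context {R : realType} {P : Type} {X : set P} {K : P -> P -> Cplx R}.
Context {H : rkhs X K}.
Local Notation C := (Cplx R).
Local Notation dot := (rk_dot H).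
Local Notation ker := (rk_ker H).
Local Notation ev := (@rk_eval R P X K H).
Implicit Types f g p q : H.

Lemma dotC f g : dot f g = (dot g f)^*.
Proof. by rewrite hermC expr0 mul1r. Qed.

Lemma norm_dotB f g :
  `|f - g| ^+ 2 = `|f| ^+ 2 + `|g| ^+ 2 - (dot f g + dot g f).
Proof. by rewrite !rk_norm dnormB (dotC g f). Qed.

Lemma parallelogram f g :
  `|f + g| ^+ 2 + `|f - g| ^+ 2 = 2 * (`|f| ^+ 2 + `|g| ^+ 2).
Proof. rewrite !rk_norm dnormB dnormD; ring. Qed.

(* The left side is the squared distance from [f] to the best multiple of [g]. *)
Lemma dot_best_approx f g : g != 0 ->
  `|f - (dot f g / dot g g) *: g| ^+ 2 =
  `|f| ^+ 2 - `|dot f g| ^+ 2 / `|g| ^+ 2.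
Proof.
move=> g0; have gg0 : dot g g != 0 by rewrite dnorm_eq0.
rewrite norm_dotB linearZl_LR linearZr_LR /= !rk_norm dnormZ.
rewrite !normCK rmorphM fmorphV /= -(dotC g g) (dotC g f).
by field.
Qed.

Lemma dot_schwarz f g : `|dot f g| <= `|f| * `|g|.
Proof.
have [->|g0] := eqVneq g 0; first by rewrite linear0r !normr0 mulr0.
rewrite -(@ler_pXn2r _ 2) ?nnegrE ?mulr_ge0 // exprMn.
have gn : 0 < `|g| ^+ 2 by rewrite exprn_gt0 // normr_gt0.
by rewrite -ler_pdivrMr // -subr_ge0 -dot_best_approx // exprn_ge0.
Qed.

Lemma ev_norm_le f w : X w -> `|ev f w| <= `|f| * `|ker w|.
Proof. by move=> Xw; rewrite rk_reproducing // dot_schwarz. Qed.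

(** Finite combinations are built one kernel at a time, so that properties of kernels extend to the
    span by induction. *)
Inductive kspan : H -> Prop :=
| kspan0 : kspan 0
| kspanDZ c w p : X w -> kspan p -> kspan (c *: ker w + p).

Lemma kspanD p q : kspan p -> kspan q -> kspan (p + q).
Proof.
move=> + hq; elim=> [|c w {}p Xw _ IH]; first by rewrite add0r.
by rewrite -addrA; apply: kspanDZ.
Qed.

Lemma kspanZ a p : kspan p -> kspan (a *: p).
Proof.
elim=> [|c w {}p Xw _ IH]; first by rewrite scaler0; exact: kspan0.
by rewrite scalerDr scalerA; apply: kspanDZ.
Qed.

Lemma evD f g z : X z -> ev (f + g) z = ev f z + ev g z.
Proof. by move=> Xz; rewrite -[f]scale1r rk_eval_linear // mul1r scale1r. Qed.

Lemma ev0 z : X z -> ev 0 z = 0.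
Proof. by move=> Xz; rewrite rk_reproducing // linear0l. Qed.

Lemma evZ a f z : X z -> ev (a *: f) z = a * ev f z.
Proof. by move=> Xz; rewrite -[_ *: _]addr0 rk_eval_linear // ev0 // addr0. Qed.

Lemma evB f g z : X z -> ev (f - g) z = ev f z - ev g z.
Proof. by move=> Xz; rewrite evD // -scaleN1r evZ // mulN1r. Qed.

Lemma ev_cvg (u : nat -> H) f z : X z ->
  u @ \oo --> f -> (fun k => ev (u k) z) @ \oo --> ev f z.
Proof.
move=> Xz uf; apply/cvgrPdist_lt => e e0.
have k1 : 0 < `|ker z| + 1 by rewrite ltr_wpDl.
move/cvgrPdist_lt : uf => /(_ (e / (`|ker z| + 1))); rewrite divr_gt0 // => uf.
near=> k.
rewrite -evB //; apply: le_lt_trans (ev_norm_le _ _ Xz) _.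
apply: (@le_lt_trans _ _ (`|f - u k| * (`|ker z| + 1))).
  by rewrite ler_wpM2l // lerDl.
rewrite -ltr_pdivlMr //; near: k; exact: uf.
Unshelve. all: by end_near.
Qed.

(** [delta] is the squared distance from [f] to the span. The order of [C] is partial, so the
    infimum is taken in [R] and embedded. *)
Lemma min_dist f : exists delta : C,
  (forall p, kspan p -> delta <= `|f - p| ^+ 2) /\
  (forall k : nat, exists2 p, kspan p & `|f - p| ^+ 2 < delta + k.+1%:R^-1).
Proof.
pose E := [set x : R | exists2 p, kspan p & `|f - p| ^+ 2 = x%:C%C].
have normE p : `|f - p| ^+ 2 = (complex.Re (`|f - p| ^+ 2 : C))%:C%C.
  by rewrite RRe_real // ger0_real // exprn_ge0.
have Elb : lbound E 0.
  by move=> x [p _ px]; rewrite -lecR -px exprn_ge0.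
have Einf : has_inf E.
  split; last by exists 0.
  by exists (complex.Re (`|f - 0| ^+ 2 : C)), 0; [exact: kspan0|].
exists (inf E)%:C%C; split.
  move=> p hp; rewrite normE lecR; apply: ge_inf; first by exists 0.
  by exists p.
move=> k.
have k0 : 0 < (k.+1%:R : R)^-1 by rewrite invr_gt0.
have [x [p hp px] xlt] := inf_adherent k0 Einf.
exists p => //; rewrite px.
suff -> : (k.+1%:R : C)^-1 = ((k.+1%:R : R)^-1)%:C%C by rewrite -rmorphD ltcR.
by rewrite fmorphV rmorph_nat.
Qed.

Lemma cvg_of_cauchy_rate (u : nat -> H) :
  (forall k l, `|u k - u l| ^+ 2 <= 2 * (k.+1%:R^-1 + l.+1%:R^-1)) ->
  exists q, u @ \oo --> q.
Proof.
move=> hu.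
suff : cvg (u @ \oo) by move=> ?; exists (lim (u @ \oo)).
apply/cauchy_cvgP/cauchy_exP => e e0.
(* Two inverses below [e ^+ 2 / 4] make the bound [2 * (_ + _)] smaller than [e ^+ 2]. *)
have e2 : 0 < e ^+ 2 / 4 by rewrite divr_gt0 // exprn_gt0.
have [N _ HN] := Cplx_natSinv_lt _ e2.
exists (u N); exists N => // l /= Nl; rewrite -ball_normE /ball_ /=.
rewrite -(@ltr_pXn2r _ 2) ?nnegrE ?(ltW e0) //.
apply: le_lt_trans (hu _ _) _.
have := ltrD (HN N (leqnn N)) (HN l Nl).
rewrite -(@ltr_pM2l _ 2) // => /lt_le_trans; apply.
by rewrite le_eqVlt; apply/orP; left; apply/eqP; field.
Qed.

(* Every function vanishing at all points is zero, so a minimising sequence for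
   the distance from [f] to the span of the kernels converges to [f]. *)
Lemma kspan_dense f :
  exists2 p : nat -> H, (forall k, kspan (p k)) & p @ \oo --> f.
Proof.
have [delta [dle dlt]] := min_dist f.
have /choice[p hp] : forall k : nat, exists p,
    kspan p /\ `|f - p| ^+ 2 < delta + k.+1%:R^-1.
  by move=> k; have [p] := dlt k; exists p.
exists p; first by move=> k; have [] := hp k.
(* The midpoint of [p k] and [p l] lies in the span, hence at squared distance at least [delta] from
   [f]; the parallelogram law then bounds [p k - p l]. *)
have pc k l : `|p k - p l| ^+ 2 <= 2 * (k.+1%:R^-1 + l.+1%:R^-1).
  have h1 : kspan (2^-1 *: (p k + p l)).
    by apply/kspanZ/kspanD; [have [] := hp k|have [] := hp l].
  have := dle _ h1.
  have -> : f - 2^-1 *: (p k + p l) = 2^-1 *: ((f - p k) + (f - p l)).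
    rewrite addrACA -opprD scalerBr; congr (_ - _).
    rewrite scalerDr -scalerDl.
    have -> : 2^-1 + 2^-1 = 1 :> C by field.
    by rewrite scale1r.
  rewrite normrZ exprMn => d1.
  have := parallelogram (f - p k) (f - p l).
  have -> : f - p k - (f - p l) = p l - p k.
    by rewrite opprB addrC addrA subrK.
  rewrite distrC => e1.
  have -> : `|p k - p l| ^+ 2 = 2 * (`|f - p k| ^+ 2 + `|f - p l| ^+ 2)
     - `|f - p k + (f - p l)| ^+ 2 by rewrite -e1 [RHS]addrC addKr.
  have d2 : 4 * delta <= `|f - p k + (f - p l)| ^+ 2.
    rewrite -ler_pdivlMl //; apply: le_trans d1 _.
    rewrite le_eqVlt; apply/orP; left; apply/eqP; congr (_ * _).
    rewrite ger0_norm ?invr_ge0 //; by field.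
  have [_ a1] := hp k; have [_ a2] := hp l.
  rewrite lerBlDr.
  apply: (@le_trans _ _ (2 * (k.+1%:R^-1 + l.+1%:R^-1) + 4 * delta)).
    have := lerD (ltW a1) (ltW a2); rewrite -(@ler_pM2l _ 2) // => /le_trans; apply.
    by rewrite le_eqVlt; apply/orP; left; apply/eqP; ring.
  by rewrite lerD2l.
have [q pq] := cvg_of_cauchy_rate _ pc.
suff -> : f = q by [].
apply: rk_eval_inj => w Xw.
(* Correcting [p k] by the best multiple of [ker w] stays in the span and cannot bring the squared
   distance below [delta], so the inner product of [f - p k] with [ker w] tends to 0. *)
have h0 : (fun k => ev (f - p k) w) @ \oo --> (0 : C).
  apply: (@Cplx_cvg0 _ _ _ (`|ker w| ^+ 2)); first by rewrite exprn_ge0.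
  move=> k; rewrite rk_reproducing //.
  have [hk a1] := hp k.
  have [->|kw0] := eqVneq (ker w) 0.
    by rewrite linear0r !normr0 expr0n mul0r.
  have kn : 0 < `|ker w| ^+ 2 by rewrite exprn_gt0 // normr_gt0.
  have h1 := kspanD _ _ (kspanDZ
    (dot (f - p k) (ker w) / dot (ker w) (ker w)) w 0 Xw kspan0) hk.
  have := dle _ h1.
  rewrite addr0 opprD addrCA addrC dot_best_approx // lerBrDr => d1.
  have := le_lt_trans d1 a1; rewrite ltrD2l => /ltW.
  by rewrite ler_pdivrMr // mulrC.
have h1 : (fun k => ev (p k) w) @ \oo --> ev f w.
  have -> : (fun k => ev (p k) w) = (fun k => ev f w - ev (f - p k) w).
    by apply/funext => k; rewrite evB // opprB addrC subrK.
  have h2 : (fun=> ev f w) @ \oo --> ev f w by exact: cvg_cst.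
  by have := @cvgB C C^o _ _ _ _ _ _ _ h2 h0; rewrite subr0; apply.
exact: (cvg_unique _ h1 (ev_cvg _ _ _ Xw pq)).
Qed.

(** The difference of the two functionals is linear and bounded, and it vanishes on a dense
    subspace. *)
Lemma eq_on_kernels (F G : H -> C) (M : C) :
  (forall a f g, F (a *: f + g) = a * F f + F g) ->
  (forall a f g, G (a *: f + g) = a * G f + G g) ->
  (forall f, `|F f - G f| <= M * `|f|) ->
  (forall w, X w -> F (ker w) = G (ker w)) -> forall f, F f = G f.
Proof.
move=> Flin Glin FGle FGker f.
pose E f := F f - G f.
have Elin a g h : E (a *: g + h) = a * E g + E h.
  by rewrite /E Flin Glin mulrBr opprD addrACA.
have E0 : E 0 = 0.
  by have := Elin (-1) 0 0; rewrite scaler0 addr0 mulN1r addNr.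
have Espan p : kspan p -> E p = 0.
  by elim=> // c w {}p Xw _ IH; rewrite Elin IH addr0 /E FGker // subrr mulr0.
apply/eqP; rewrite -subr_eq0 -/(E f); apply/negP => /negP Ef0.
have M1 : 0 < `|M| + 1 by rewrite ltr_wpDl.
have [p hp pf] := kspan_dense f.
move/cvgrPdist_lt : pf => /(_ (`|E f| / (`|M| + 1))).
rewrite divr_gt0 ?normr_gt0 // => /(_ isT) [N _ /(_ N (leqnn N)) /=].
rewrite ltr_pdivlMr // => h.
suff : `|E f| <= `|f - p N| * (`|M| + 1) by move/le_lt_trans => /(_ _ h); rewrite ltxx.
have -> : E f = E (f - p N).
  rewrite (_ : f - p N = -1 *: p N + f); last by rewrite scaleN1r addrC.
  by rewrite Elin (Espan (p N)) // mulr0 add0r.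
have h2 := FGle (f - p N); rewrite -/(E _) in h2.
apply: le_trans h2 _.
(* [M] is an arbitrary scalar, but this product dominates a norm, so it is nonnegative and equals
   its own modulus. *)
have h3 : 0 <= M * `|f - p N| := le_trans (normr_ge0 _) (FGle _).
rewrite -(ger0_norm h3) normrM normr_id mulrC.
by rewrite ler_wpM2l // lerDl.
Qed.

End rkhs.

(** * The conjugation [J] and complex symmetry tested on kernels *)

Section conjugation.
Context {R : realType} {d gamma : nat} {H : Hspace R d gamma}.
Local Notation C := (Cplx R).
Local Notation Cd := 'rV[C]_d.
Local Notation dot := (rk_dot H).
Local Notation ker := (rk_ker H).
Local Notation ev := (@rk_eval R Cd polydisk (Defs.kernel gamma) H).
Local Notation cj := (map_mx (Num.conj : C -> C)).
Implicit Types f g p q : H.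

Lemma cjK : involutive (cj : Cd -> Cd).
Proof. by move=> w; apply/matrixP => i j; rewrite !mxE conjCK. Qed.

Lemma polydisk_cj (w : Cd) : polydisk w -> polydisk (cj w).
Proof. by move=> hw j; rewrite /disk /= mxE norm_conjC; exact: hw. Qed.

Lemma kernel_cj (w z : Cd) : Defs.kernel gamma (cj w) (cj z) = (Defs.kernel gamma w z)^*.
Proof.
rewrite /Defs.kernel rmorph_prod; apply: eq_bigr => j _.
by rewrite fmorphV rmorphXn /= rmorphB rmorph1 rmorphM /= !mxE !conjCK.
Qed.

(** The graph of [J], usable before every [f] is known to have a conjugate in the space. *)
Definition conj_pair f g := forall z, polydisk z -> ev g z = (ev f (cj z))^*.

Lemma conj_pair_sym f g : conj_pair f g -> conj_pair g f.
Proof.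
by move=> fg z hz; rewrite fg ?cjK ?conjCK //; exact: polydisk_cj.
Qed.

Lemma conj_pair0 : conj_pair 0 0.
Proof. by move=> z hz; rewrite !ev0 ?conjC0 //; exact: polydisk_cj. Qed.

Lemma conj_pairDZ a f g f' g' : conj_pair f g -> conj_pair f' g' ->
  conj_pair (a *: f + f') (a^* *: g + g').
Proof.
move=> fg fg' z hz; have hz' := polydisk_cj _ hz.
by rewrite !rk_eval_linear // fg // fg' // rmorphD rmorphM.
Qed.

Lemma conj_pair_ker w : polydisk w -> conj_pair (ker w) (ker (cj w)).
Proof.
move=> hw z hz; have hz' := polydisk_cj _ hz; have hw' := polydisk_cj _ hw.
by rewrite !rk_kerE // -kernel_cj cjK.
Qed.

Lemma conj_pair_dot_ker f g w : polydisk w -> conj_pair f g ->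
  dot g (ker (cj w)) = (dot f (ker w))^*.
Proof.
move=> hw fg; have hw' := polydisk_cj _ hw.
by rewrite -!rk_reproducing // fg // cjK.
Qed.

(** Conjugating coefficients and base points conjugates a combination of kernels. The clause on
    inner products is what makes the conjugation isometric on the span. *)
Lemma kspan_conj_pair p : kspan p ->
  exists2 q, conj_pair p q &
    forall f g, conj_pair f g -> dot g q = (dot f p)^*.
Proof.
elim=> [|c w {}p hw _ [q pq hq]].
  exists 0; first exact: conj_pair0.
  by move=> f g _; rewrite !linear0r conjC0.
exists (c^* *: ker (cj w) + q).
  by apply: conj_pairDZ => //; exact: conj_pair_ker.
move=> f g fg; rewrite !linearDr !linearZr_LR /=.
by rewrite (hq _ _ fg) (conj_pair_dot_ker _ _ _ hw fg) rmorphD rmorphM.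
Qed.

(** Approximate [f] by [p k] in the span. The conjugates [q k] have the same mutual distances, hence
    converge, and evaluation passes to the limit. *)
Lemma conj_pair_exists f : exists2 g, conj_pair f g & `|g| = `|f|.
Proof.
have [p hp pf] := kspan_dense f.
have /choice[q hq] : forall k, exists q, conj_pair (p k) q /\
    forall f g, conj_pair f g -> dot g q = (dot f (p k))^*.
  by move=> k; have [q ? ?] := kspan_conj_pair _ (hp k); exists q.
have dotq k l : dot (q k) (q l) = (dot (p k) (p l))^*.
  by have [_ h] := hq l; apply: h; have [] := hq k.
have normq k l : `|q k - q l| = `|p k - p l|.
  apply/eqP; rewrite -(@eqrXn2 _ 2) // !norm_dotB !rk_norm !dotq.
  by rewrite -!dotC; apply/eqP; ring.
have normq1 k : `|q k| = `|p k|.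
  by apply/eqP; rewrite -(@eqrXn2 _ 2) // !rk_norm !dotq -dotC.
have [g qg] : exists g, q @ \oo --> g.
  suff : cvg (q @ \oo) by move=> ?; exists (lim (q @ \oo)).
  apply/cauchy_cvgP/cauchy_ballP => e e0.
  have /cvg_cauchy/cauchy_ballP/(_ e e0) : cvg (p @ \oo) by apply/cvg_ex; exists f.
  rewrite !near_map2; apply: filterS => -[k l] /=.
  by rewrite -!ball_normE /ball_ /= normq.
exists g.
  move=> z hz; have hz' := polydisk_cj _ hz.
  have h1 := ev_cvg _ _ _ hz qg.
  have h2 := ev_cvg _ _ _ hz' pf.
  apply: (cvg_unique (@norm_hausdorff C C^o) h1) => /=.
  apply/cvgrPdist_lt => e e0; move/cvgrPdist_lt : h2 => /(_ e e0).
  by apply: filterS => k; have [-> // _] := hq k; rewrite -rmorphB norm_conjC.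
have h1 : (fun k => `|q k| : C^o) @ \oo --> (`|g| : C^o) by exact: cvg_norm.
have h2 : (fun k => `|p k| : C^o) @ \oo --> (`|f| : C^o) by exact: cvg_norm.
have e : (fun k => `|q k| : C^o) = (fun k => `|p k| : C^o).
  by apply/funext => k; exact: normq1.
rewrite e in h1.
exact: (cvg_unique (@norm_hausdorff C C^o) h1 h2).
Qed.

(** Since a conjugate exists, [xget] returns one and not its default value 0. *)
Lemma JE f : conj_pair f (J H f).
Proof.
have [g fg _] := conj_pair_exists f.
by rewrite /J; case: xgetP => [h _ /= |/(_ g)].
Qed.

Lemma conj_pair_J f g : conj_pair f g -> g = J H f.
Proof. by move=> fg; apply: rk_eval_inj => z hz; rewrite fg // JE. Qed.

Lemma J_linear a f g : J H (a *: f + g) = a^* *: J H f + J H g.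
Proof. by apply/esym/conj_pair_J/conj_pairDZ; exact: JE. Qed.

Lemma J_norm f : `|J H f| = `|f|.
Proof. by have [g /conj_pair_J <-] := conj_pair_exists f. Qed.

Lemma JK : involutive (J H).
Proof. by move=> f; apply/esym/conj_pair_J/conj_pair_sym/JE. Qed.

Lemma J_conjugation : conjugation (J H).
Proof. by split; [exact: J_linear|exact: J_norm|exact: JK]. Qed.

Lemma J_ker w : polydisk w -> J H (ker w) = ker (cj w).
Proof. by move=> hw; apply/esym/conj_pair_J/conj_pair_ker. Qed.

(* Complex symmetry says that the bilinear form [dot (D f) (J g)] is symmetric;
   it suffices to test it on reproducing kernels. *)
Lemma complex_symmetricP (D : {linear H -> H}) : bounded_operator D ->
  complex_symmetric dot (J H) D <->
  forall x y, polydisk x -> polydisk y ->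
    ev (D (ker (cj y))) x = ev (D (ker (cj x))) y.
Proof.
move=> [M DM]; split=> [[_ [S [DS DJSJ]]] x y hx hy|Dsym].
  have hx' := polydisk_cj _ hx; have hy' := polydisk_cj _ hy.
  rewrite [LHS]rk_reproducing // DS dotC -rk_reproducing //.
  by rewrite DJSJ J_ker // cjK JE.
split; first exact: J_conjugation.
(* The adjoint must be [J D J]; the adjoint identity is proved by density, first in [f] and then in
   [g]. *)
exists (fun f => J H (D (J H f))); split; last by move=> f; rewrite !JK.
have JDJ_linear a f g :
    J H (D (J H (a *: f + g))) = a *: J H (D (J H f)) + J H (D (J H g)).
  by rewrite J_linear linearP J_linear conjCK.
have dot_linear h a f g : dot (a *: f + g) h = a * dot f h + dot g h.
  by rewrite linearDl linearZl_LR.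
have JDJ_le f : `|J H (D (J H f))| <= M * `|f|.
  by rewrite J_norm (le_trans (DM _)) // J_norm.
move=> f g; apply: (eq_on_kernels (fun f => dot (D f) g)
    (fun f => dot f (J H (D (J H g)))) (M * `|g| + `|J H (D (J H g))|)).
- by move=> a f1 f2; rewrite linearP dot_linear.
- by move=> a f1 f2; rewrite dot_linear.
- move=> h; apply: le_trans (ler_normB _ _) _; rewrite mulrDl; apply: lerD.
    apply: le_trans (dot_schwarz _ _) _.
    by rewrite mulrAC ler_wpM2r.
  by apply: le_trans (dot_schwarz _ _) _; rewrite mulrC.
move=> w hw; have hw' := polydisk_cj _ hw.
(* Swapping the arguments moves [g] to the linear slot of [dot], so the density argument applies
   again. *)
rewrite dotC [RHS]dotC; congr (_^*).
apply: (eq_on_kernels (fun g => dot g (D (ker w)))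
    (fun g => dot (J H (D (J H g))) (ker w)) (`|D (ker w)| + M * `|ker w|)).
- by move=> a f1 f2; rewrite dot_linear.
- by move=> a f1 f2; rewrite JDJ_linear dot_linear.
- move=> h; apply: le_trans (ler_normB _ _) _; rewrite mulrDl; apply: lerD.
    by apply: le_trans (dot_schwarz _ _) _; rewrite mulrC.
  apply: le_trans (dot_schwarz _ _) _.
  by rewrite mulrAC ler_wpM2r.
move=> u hu; have hu' := polydisk_cj _ hu.
rewrite dotC -!rk_reproducing // JE // J_ker //; congr (_^*).
by rewrite -[w]cjK [LHS]Dsym // cjK.
Qed.

End conjugation.

(** * Iterated derivatives of a polynomial times a negative power of [1 - c z] *)

Section rational_derivatives.
Context {K : numFieldType}.
Implicit Types (P : {poly K}) (c z : K).

Lemma is_derive_horner P z : is_derive z 1 (fun t : K => P.[t]) P^`().[z].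
Proof.
elim/poly_ind: P => [|P r IH].
  rewrite deriv0 horner0; under eq_fun do rewrite horner0.
  exact: is_derive_cst.
have -> : (fun t : K => (P * 'X + r%:P).[t]) =
    (fun t => P.[t]) * id + cst r.
  by apply/funext => t; rewrite !hornerE.
apply: is_derive_eq.
rewrite derivD derivM derivX derivC !hornerE /= /GRing.scale /=; ring.
Qed.

(* The [k]-th derivative of [P.[z] * (1 - c z)^-m] is
   [(num_iter c m P k).[z] * (1 - c z)^-(m + k)]. *)
Fixpoint num_iter c m P k : {poly K} :=
  if k is k'.+1 then
    (num_iter c m P k')^`() * (1 - c *: 'X) + ((m + k')%:R * c) *: num_iter c m P k'
  else P.

Definition rat_iter c m P k z : K :=
  (num_iter c m P k).[z] * (1 - c * z) ^- (m + k).

Lemma is_derive_rat_iter c m P k z : 1 - c * z != 0 ->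
  is_derive z 1 (rat_iter c m P k) (rat_iter c m P k.+1 z).
Proof.
move=> cz.
have dq : is_derive z 1 (fun t : K => 1 - c * t) (- c).
  have -> : (fun t : K => 1 - c * t) = cst 1 - (c *: id).
    by apply/funext => t.
  apply: is_derive_eq.
  by rewrite sub0r /GRing.scale /= mulr1.
have dqn : is_derive z 1 (fun t : K => (1 - c * t) ^+ (m + k))
   (((m + k)%:R * (1 - c * z) ^+ (m + k).-1) *: - c).
  have -> : (fun t : K => (1 - c * t) ^+ (m + k)) =
      (fun t : K => 1 - c * t) ^+ (m + k) by apply/funext => t; rewrite exprfctE.
  exact: is_deriveX.
have dqV : is_derive z 1 (fun t : K => (1 - c * t) ^- (m + k))
   ((m + k)%:R * c * (1 - c * z) ^- (m + k).+1).
  have h : (1 - c * z) ^+ (m + k) != 0 by rewrite expf_neq0.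
  apply: DeriveDef.
    apply: (@derivableV K K) => //.
  rewrite (@deriveV K K) // derive_val /GRing.scale /=.
  (* The power rule involves [(m + k).-1], so exponent 0 is separate. *)
  case: (m + k)%N => [|N]; first by rewrite !mul0r mulr0.
  by rewrite /= !exprS; field; rewrite cz expf_neq0.
have -> : (rat_iter c m P k) =
    (fun t : K => (num_iter c m P k).[t]) * (fun t => (1 - c * t) ^- (m + k)).
  by apply/funext.
have dP := is_derive_horner (num_iter c m P k) z.
apply: is_derive_eq.
rewrite /rat_iter /= addnS !hornerE /GRing.scale /= exprS.
by field; rewrite cz expf_neq0.
Qed.

(** From a constant numerator only the scalar term of the recursion survives, producing a rising
    factorial. This is the case of the factors of the kernel. *)
Lemma num_iter_const c m k :
  num_iter c m 1 k = ((\prod_(i < k) (m + i)%:R) * c ^+ k)%:P.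
Proof.
elim: k => [|k IH]; first by rewrite big_ord0 mul1r.
rewrite /= IH derivC mul0r add0r -mul_polyC -polyCM big_ord_recr /= exprS.
by congr (_%:P); ring.
Qed.

(** This is the case of the factors of [psi], and the source of the factorials in the constant of
    the theorem. *)
Lemma num_iter_Xn c m n : (num_iter c m 'X^n n).[0] = n`!%:R.
Proof.
(* After [k] steps the numerator vanishes to order [n - k] and its lowest coefficient is a falling
   factorial; only the derivative of the lowest term feeds the next one. *)
suff h : forall k, (k <= n)%N ->
    (num_iter c m 'X^n k)`_(n - k) = (n ^_ k)%:R /\
    forall i, (i < n - k)%N -> (num_iter c m 'X^n k)`_i = 0.
  by have [+ _] := h n (leqnn n); rewrite subnn -horner_coef0 ffactnn.
elim=> [_|k IH kn].
  rewrite subn0 coefXn eqxx ffactn0; split => // i.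
  by rewrite ltn_neqAle coefXn => /andP[/negbTE ->].
have [h1 h2] := IH (ltnW kn).
have coefE i : (num_iter c m 'X^n k.+1)`_i =
    (num_iter c m 'X^n k)`_i.+1 *+ i.+1
    - c * (num_iter c m 'X^n k)`_i *+ i
    + (m + k)%:R * c * (num_iter c m 'X^n k)`_i.
  rewrite /= mulrBr mulr1 -scalerAr coefD coefB !coefZ coefMX !coef_deriv.
  by case: i => [|i] /=; rewrite ?mulr0 ?mulr0n // mulrnAr.
have nk : (n - k = (n - k.+1).+1)%N by rewrite subnSK.
split.
  rewrite coefE -nk h1 (h2 (n - k.+1)%N); last by rewrite nk.
  by rewrite !mulr0 mul0rn subr0 addr0 ffactnSr natrM mulr_natr.
move=> i hi.
have hi1 : (i.+1 < n - k)%N by rewrite nk ltnS.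
by rewrite coefE !h2 ?mul0rn ?mulr0 ?mul0rn ?subr0 ?addr0 // ltnW.
Qed.

End rational_derivatives.

(** * Mixed partial derivatives of products of one-variable functions *)

Section mpartial.
Context {R : realType} {d : nat}.
Local Notation C := (Cplx R).
Local Notation Cd := 'rV[C]_d.
Implicit Types (g : 'I_d -> nat -> C -> C) (F : Cd -> C) (e : 'I_d -> nat).

Lemma near_polydisk (z : Cd) : polydisk z -> \forall y \near z, polydisk y.
Proof.
move=> hz; apply: (@filter_forall _ 'I_d (fun j y => disk (y ord0 j)) (nbhs z)) => j.
have : continuous (fun y : Cd => y ord0 j) by exact: coord_continuous.
move=> /(_ z)/cvgrPdist_lt/(_ (1 - `|z ord0 j|)).
rewrite subr_gt0 => /(_ (hz j)); apply: filterS => y hy.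
rewrite /disk /=; rewrite ltrBrDl in hy; apply: le_lt_trans hy.
by have := ler_normB (z ord0 j) (z ord0 j - y ord0 j); rewrite subKr.
Qed.

(** [g j k] stands for the [k]-th derivative of the factor in variable [j], so that differentiating
    a product shifts an index. *)
Variable g : 'I_d -> nat -> C -> C.
Hypothesis dg : forall j k z, disk z ->
  is_derive z 1 (g j k) (g j k.+1 z).

Lemma partial_prod a F e j :
  (forall z, polydisk z -> F z = a * \prod_i g i (e i) (z ord0 i)) ->
  forall z, polydisk z ->
  Defs.partial j F z = a * \prod_i g i (e i + (i == j))%N (z ord0 i).
Proof.
move=> hF z hz.
pose c := \prod_(i | i != j) g i (e i) (z ord0 i).
have -> : Defs.partial j F z =
    'D_(delta_mx ord0 j) (fun z : Cd => a * \prod_i g i (e i) (z ord0 i)) z.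
  apply: near_eq_derive; have := near_polydisk _ hz.
  by apply: filterS => y hy; exact: hF.
(* In direction [j] the other factors are constant, so the difference quotients are those of a
   one-variable function. *)
have -> : 'D_(delta_mx ord0 j) (fun z : Cd => a * \prod_i g i (e i) (z ord0 i)) z
   = 'D_1 ((a * c) *: (g j (e j))) (z ord0 j).
  rewrite /derive; apply: (f_equal (fun f : C -> C => lim (f @ 0^'))).
  apply/funext => h; congr (_ *: (_ - _)).
    rewrite /= (bigD1 j) //= mulrCA mulrC; congr (_ * _ * _).
      apply: eq_bigr => i ij; congr (g _ _ _).
      by rewrite !mxE eqxx (negbTE ij) mulr0 add0r.
    by rewrite !mxE !eqxx.
  by rewrite (bigD1 j) //= mulrCA mulrC.
have hj := dg j (e j) _ (hz j).
rewrite derive_val (bigD1 j) //= eqxx addn1 mulrCA [RHS]mulrC; congr (_ * _ * _).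
by apply: eq_bigr => i /negbTE ->; rewrite addn0.
Qed.

Lemma iter_partial_prod a F e j m :
  (forall z, polydisk z -> F z = a * \prod_i g i (e i) (z ord0 i)) ->
  forall z, polydisk z ->
  iter m (Defs.partial j) F z = a * \prod_i g i (e i + (i == j) * m)%N (z ord0 i).
Proof.
move=> hF; elim: m => [|m IH] z hz.
  by rewrite /= hF //; congr (_ * _); apply: eq_bigr => i _; rewrite muln0 addn0.
rewrite iterS (partial_prod a _ (fun i => e i + (i == j) * m)%N) //.
by congr (_ * _); apply: eq_bigr => i _; rewrite -addnA mulnS [(_ * m + _)%N]addnC.
Qed.

Lemma mpartial_prod a n F :
  (forall z, polydisk z -> F z = a * \prod_i g i 0%N (z ord0 i)) ->
  forall z, polydisk z -> mpartial n F z = a * \prod_i g i (n i) (z ord0 i).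
Proof.
move=> hF z hz.
(* The sum counts the derivatives in variable [i] taken along [s]; over the full enumeration it
   collapses to [n i]. *)
have h s : forall z, polydisk z ->
    foldr (fun j f => iter (n j) (Defs.partial j) f) F s z =
    a * \prod_i g i (\sum_(j <- s) (i == j) * n j)%N (z ord0 i).
  elim: s => [|j s IH] {hz}z hz /=.
    by rewrite hF //; congr (_ * _); apply: eq_bigr => i _; rewrite big_nil.
  rewrite (iter_partial_prod _ _ _ _ _ IH) //.
  by congr (_ * _); apply: eq_bigr => i _; rewrite big_cons addnC.
rewrite /mpartial h //; congr (_ * _); apply: eq_bigr => i _; congr (g i _ _).
rewrite big_enum /= (bigD1 i) //= eqxx mul1n big1 ?addn0 // => j.
by rewrite eq_sym => /negbTE ->.
Qed.

End mpartial.

(** * Limits of powers and finite products *)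

Section cvg_products.
Context {K : numFieldType} {T : Type} {F : set_system T} {FF : Filter F}.

Lemma cvg_exprn (f : T -> K) (l : K) m :
  f x @[x --> F] --> l -> f x ^+ m @[x --> F] --> l ^+ m.
Proof.
move=> fl; elim: m => [|m IH]; first exact: cvg_cst.
rewrite exprS; under eq_fun do rewrite exprS.
exact: cvgM.
Qed.

Lemma cvg_prodr (I : finType) (f : I -> T -> K) (l : I -> K) :
  (forall i, f i x @[x --> F] --> l i) ->
  \prod_i f i x @[x --> F] --> \prod_i l i.
Proof.
by move=> fl; apply: cvg_big => // -[x y]; exact: mul_continuous.
Qed.

Lemma cvg_subM_exprVn (f g : T -> K) (a b : K) m : 1 - a * b != 0 ->
  f x @[x --> F] --> a -> g x @[x --> F] --> b ->
  (1 - f x * g x) ^- m @[x --> F] --> (1 - a * b) ^- m.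
Proof.
move=> ab fa gb; apply: cvgV; first by rewrite expf_neq0.
by apply: cvg_exprn; apply: cvgB; [exact: cvg_cst|exact: cvgM].
Qed.

End cvg_products.

(** * Complex symmetry as a relation between [psi] and [phi] *)

Section symbols.
Context {R : realType} {d gamma : nat}.
Local Notation C := (Cplx R).
Local Notation Cd := 'rV[C]_d.
Variables (n : 'I_d -> nat) (psi : Cd -> C) (phi : 'I_d -> C -> C).
Hypothesis gamma_ge1 : (1 <= gamma)%N.
Hypothesis phi_self :
  forall z : Cd, polydisk z -> polydisk (prod_map phi z).

Lemma disk0 : disk (0 : C).
Proof. by rewrite /disk /= normr0. Qed.

Lemma disk_half : disk (2^-1 : C).
Proof. by rewrite /disk /= normfV normr_nat invf_lt1 // ltr1n. Qed.

Lemma phi_disk t z : disk z -> disk (phi t z).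
Proof.
(* [z] is padded with zeros to a point of the polydisk. *)
move=> hz; pose w : Cd := \row_j (if j == t then z else 0).
have hw : polydisk w.
  by move=> j; rewrite /w mxE; case: ifP => _ //; exact: disk0.
by have := phi_self _ hw t; rewrite /prod_map !mxE eqxx.
Qed.

Lemma disk_subM_neq0 (x y : C) : disk x -> disk y -> 1 - x * y != 0.
Proof.
move=> hx hy; rewrite subr_eq0 eq_sym; apply: contraTneq isT => xy1.
have : `|x * y| < 1 by rewrite normrM mulr_ilt1.
by rewrite xy1 normr1 ltxx.
Qed.

Definition symbol_sym := forall x y : Cd, polydisk x -> polydisk y ->
  psi x * \prod_j (y ord0 j ^+ n j *
     (1 - y ord0 j * phi j (x ord0 j)) ^- (gamma + n j)) =
  psi y * \prod_j (x ord0 j ^+ n j *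
     (1 - x ord0 j * phi j (y ord0 j)) ^- (gamma + n j)).

(** The kernel is based at the conjugate of [y], so its factors are [(1 - y_j z_j)^-gamma], without
    conjugation. *)
Lemma comp_diff_kernel (F : Cd -> C) (x y : Cd) :
  polydisk x -> polydisk y ->
  (forall z, polydisk z -> F z = Defs.kernel gamma (map_mx Num.conj y) z) ->
  comp_diff n psi (prod_map phi) F x =
  \prod_(j < d) \prod_(i < n j) (gamma + i)%:R *
  (psi x * \prod_j (y ord0 j ^+ n j *
     (1 - y ord0 j * phi j (x ord0 j)) ^- (gamma + n j))).
Proof.
move=> hx hy hF; rewrite /comp_diff.
pose g (j : 'I_d) k z := rat_iter (y ord0 j) gamma 1 k z.
rewrite (mpartial_prod g _ 1 n F _ _ (phi_self _ hx)); first last.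
- move=> z hz; rewrite hF // mul1r; apply: eq_bigr => j _.
  by rewrite /g /rat_iter /= hornerC mul1r addn0 mxE conjCK.
- by move=> j k z hz; apply: is_derive_rat_iter; apply: disk_subM_neq0.
rewrite mul1r mulrCA -big_split /=; congr (_ * _); apply: eq_bigr => j _.
by rewrite /g /rat_iter num_iter_const hornerC mxE !mulrA.
Qed.

Lemma symbol_symP (H : Hspace R d gamma) (D : {linear H -> H}) :
  bounded_operator D -> realizes D (comp_diff n psi (prod_map phi)) ->
  complex_symmetric (rk_dot H) (J H) D <-> symbol_sym.
Proof.
move=> D_bounded D_def.
pose c : C := \prod_(j < d) \prod_(i < n j) (gamma + i)%:R.
(* The rising factorials are nonzero because [gamma] is positive, so they cancel from the
   relation. *)
have c0 : c != 0.
  apply/prodf_neq0 => j _; apply/prodf_neq0 => i _.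
  by rewrite pnatr_eq0 addn_eq0 negb_and -lt0n gamma_ge1.
have DK x y : polydisk x -> polydisk y ->
    rk_eval (D (rk_ker H (map_mx Num.conj y))) x =
    c * (psi x * \prod_j (y ord0 j ^+ n j *
      (1 - y ord0 j * phi j (x ord0 j)) ^- (gamma + n j))).
  move=> hx hy; rewrite D_def //; apply: comp_diff_kernel => // z hz.
  by rewrite rk_kerE //; exact: polydisk_cj.
apply: (iff_trans (complex_symmetricP _ D_bounded)); split=> h x y hx hy.
  apply: (mulfI c0).
  exact: etrans (esym (DK x y hx hy)) (etrans (h x y hx hy) (DK y x hy hx)).
exact: etrans (DK x y hx hy)
  (etrans (congr1 ( *%R c) (h x y hx hy)) (esym (DK y x hy hx))).
Qed.

Lemma symbol_sym_of_formulas (a : C) (b : 'I_d -> C) :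
  (forall z : Cd, polydisk z -> psi z = a * \prod_(j < d)
       (z ord0 j ^+ n j * (1 - z ord0 j * phi j 0) ^- (gamma + n j))) ->
  (forall t z, disk z -> phi t z = phi t 0 + (1 - z * phi t 0)^-1 * z * b t) ->
  symbol_sym.
Proof.
move=> hpsi hphi x y hx hy.
rewrite (hpsi x hx) (hpsi y hy) -[LHS]mulrA -[RHS]mulrA.
congr (_ * _); rewrite -!big_split; apply: eq_bigr => j _ /=.
have nz z : disk z -> 1 - z * phi j 0 != 0.
  by move=> hz; apply: disk_subM_neq0 => //; apply: phi_disk; exact: disk0.
(* Both sides equal [(1 - x c) (1 - y c) - x y b] with [c = phi j 0] and [b = b j], which is
   symmetric in [x] and [y]. *)
have key : (1 - x ord0 j * phi j 0) * (1 - y ord0 j * phi j (x ord0 j)) =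
           (1 - y ord0 j * phi j 0) * (1 - x ord0 j * phi j (y ord0 j)).
  rewrite (hphi j (x ord0 j)) ?(hphi j (y ord0 j)) //.
  by field; rewrite !nz //.
rewrite [LHS]mulrACA [RHS]mulrACA -!invfM -!exprMn key.
by rewrite [x ord0 j * y ord0 j]mulrC.
Qed.

(** * Recovering [psi] and [phi] from the symmetry relation *)

Hypothesis phi_holo : holomorphic (prod_map phi).

Lemma phi_derivable t : derivable (phi t) 0 1.
Proof.
apply/derivable1_diffP.
have h0 : polydisk (0 : Cd) by move=> j; rewrite mxE; exact: disk0.
have -> : phi t = (fun M : Cd => M ord0 t) \o
    (prod_map phi \o (fun z : C => z *: (delta_mx ord0 t : Cd))).
  by apply/funext => z; rewrite /= !mxE !eqxx mulr1.
apply: differentiable_comp; last exact: differentiable_coord.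
apply: differentiable_comp; first exact: differentiableZl.
by rewrite scale0r; exact: phi_holo.
Qed.

Lemma phi_cvg0 t : phi t x @[x --> 0^'] --> phi t 0.
Proof.
apply: cvg_within_filter.
exact/differentiable_continuous/derivable1_diffP/phi_derivable.
Qed.

Lemma psi_formula : symbol_sym ->
  exists a, forall x : Cd, polydisk x -> psi x =
    a * \prod_j (x ord0 j ^+ n j * (1 - x ord0 j * phi j 0) ^- (gamma + n j)).
Proof.
move=> psi_sym.
pose E (x : Cd) (y : C) := \prod_j (1 - y * phi j (x ord0 j)) ^- (gamma + n j).
pose G (x : Cd) (y : C) :=
  \prod_j (x ord0 j ^+ n j * (1 - x ord0 j * phi j y) ^- (gamma + n j)).
have E_cvg x : polydisk x -> E x y @[y --> 0^'] --> (1 : C).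
  move=> hx; have -> : 1 = E x 0.
    by rewrite /E big1 // => j _; rewrite mul0r subr0 expr1n invr1.
  apply: cvg_prodr => j; apply: cvg_subM_exprVn; last exact: cvg_cst.
    by rewrite mul0r subr0 oner_neq0.
  exact: cvg_within_filter cvg_id.
have G_cvg x : polydisk x -> G x y @[y --> 0^'] --> G x 0.
  move=> hx; apply: cvg_prodr => j; apply: cvgM; first exact: cvg_cst.
  apply: cvg_subM_exprVn; [|exact: cvg_cst|exact: phi_cvg0].
  by apply: disk_subM_neq0 => //; apply: phi_disk; exact: disk0.
(* A reference point with no zero coordinate, so that [G x0 0] is nonzero. *)
pose x0 : Cd := const_mx 2^-1.
have hx0 : polydisk x0 by move=> j; rewrite mxE; exact: disk_half.
have Gx0 : G x0 0 != 0.
  apply/prodf_neq0 => j _; rewrite mxE mulf_neq0 ?expf_neq0 ?invr_eq0 //.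
  rewrite expf_neq0 // disk_subM_neq0 //; first exact: disk_half.
  by apply: phi_disk; exact: disk0.
have sym y z : disk y -> polydisk z ->
    \prod_(j < d) y ^+ n j * (psi z * E z y) = psi (const_mx y) * G z y.
  move=> hy hz; have hw : polydisk (const_mx y : Cd) by move=> j; rewrite mxE.
  rewrite mulrCA -big_split /=.
  have := psi_sym z _ hz hw.
  under eq_bigr do rewrite mxE; move=> ->.
  by under eq_bigr do rewrite mxE.
(* Comparing [x] with [x0] eliminates the unknown value of [psi] at the diagonal point
   [const_mx y]. *)
suff h x : polydisk x -> psi x * G x0 0 = psi x0 * G x 0.
  by exists (psi x0 / G x0 0) => x /h e; rewrite mulrAC -[LHS](mulfK Gx0) e.
clearbody E G => hx.
have lhs : psi x * E x y * G x0 y @[y --> 0^'] --> psi x * 1 * G x0 0.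
  by apply: cvgM (G_cvg _ hx0); apply: cvgM (E_cvg _ hx); exact: cvg_cst.
have rhs : psi x0 * E x0 y * G x y @[y --> 0^'] --> psi x0 * 1 * G x 0.
  by apply: cvgM (G_cvg _ hx); apply: cvgM (E_cvg _ hx0); exact: cvg_cst.
rewrite !mulr1 in lhs rhs.
apply: (cvg_unique (@norm_hausdorff C C) lhs).
(* The product of the [y ^+ n j] can be cancelled for [y != 0], hence limits over punctured
   neighbourhoods. *)
apply: cvg_trans rhs; apply: near_eq_cvg; near=> y.
have y0 : y != 0 by near: y; exact: nbhs_dnbhs_neq.
have hy : disk y by near: y; exact: dnbhs0_lt.
have yn0 : \prod_(j < d) y ^+ n j != 0.
  by apply/prodf_neq0 => j _; rewrite expf_neq0.
apply: (mulfI yn0); rewrite [LHS]mulrA [RHS]mulrA.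
by rewrite (sym y x) // (sym y x0) // mulrAC.
Unshelve. all: by end_near. Qed.

Lemma phi_formula (a : C) : a != 0 ->
  (forall x : Cd, polydisk x -> psi x =
    a * \prod_j (x ord0 j ^+ n j * (1 - x ord0 j * phi j 0) ^- (gamma + n j))) ->
  symbol_sym -> forall t z, disk z ->
  phi t z = phi t 0 + (1 - z * phi t 0)^-1 * z * derive1 (phi t) 0.
Proof.
move=> a0 hpsi psi_sym t x hx.
have phi0 j : disk (phi j 0) by apply: phi_disk; exact: disk0.
pose m := (gamma + n t)%N; pose c := phi t 0.
pose u (x y : C) := (1 - x * c) * (1 - y * phi t x).
have usym y : disk y -> x != 0 -> y != 0 -> u x y ^+ m = u y x ^+ m.
  move=> hy x0 y0.
  pose q j (x y : C) := x ^+ n j * (1 - x * phi j 0) ^- (gamma + n j) *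
    (y ^+ n j * (1 - y * phi j x) ^- (gamma + n j)).
  (* Only coordinate [t] varies. The others stay at one half, where they contribute the same nonzero
     factor to both sides. *)
  pose v (s : C) : Cd := \row_j (if j == t then s else 2^-1).
  have hv s : disk s -> polydisk (v s).
    by move=> hs j; rewrite /v mxE; case: ifP => // _; exact: disk_half.
  have := psi_sym _ _ (hv _ hx) (hv _ hy).
  rewrite !hpsi; try exact: hv.
  rewrite -[LHS]mulrA -[RHS]mulrA => /(mulfI a0); rewrite -!big_split /=.
  rewrite (bigD1 t) // [RHS](bigD1 t) //= !mxE !eqxx.
  rewrite (eq_bigr (fun j => q j 2^-1 2^-1)); last first.
    by move=> j jt; rewrite !mxE (negbTE jt).
  rewrite [X in _ = _ * X](eq_bigr (fun j => q j 2^-1 2^-1)); last first.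
    by move=> j jt; rewrite !mxE (negbTE jt).
  have q0 : \prod_(j < d | j != t) q j 2^-1 2^-1 != 0.
    have h0 : (2^-1 : C) != 0 by rewrite invr_eq0.
    apply/prodf_neq0 => j _; have hh := disk_half.
    by rewrite !mulf_neq0 ?invr_eq0 ?expf_neq0 ?disk_subM_neq0 //; exact: phi_disk.
  move=> /(mulIf q0).
  rewrite [LHS]mulrACA [RHS]mulrACA -!invfM -!exprMn -/(u x y) -/(u y x) -/m.
  rewrite [y * x]mulrC => /(mulfI _) h; apply/invr_inj/h.
  by rewrite expf_neq0 // mulf_neq0.
have [->|x0] := eqVneq x 0; first by rewrite mulr0 mul0r addr0.
have cx : 1 - x * c != 0 by apply: disk_subM_neq0 => //; exact: phi0.
have near_disk : \forall y \near (0 : C), disk y.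
  by apply: nbhs0_lt.
(* At [y = 0] both sides are [(1 - x c)^m], so the relation holds on a full neighbourhood and can be
   differentiated there. *)
have fg : \forall y \near (0 : C), u x y ^+ m = u y x ^+ m.
  apply: filterS near_disk => y hy.
  have [->|y0] := eqVneq y 0; last exact: usym.
  by rewrite /u !mul0r !subr0 mul1r mulr1.
have dphi : is_derive (0 : C) 1 (phi t) (derive1 (phi t) 0).
  by apply: DeriveDef; [exact: phi_derivable|rewrite derive1E].
have df : is_derive (0 : C) 1 (fun y => u x y ^+ m)
    (m%:R * (1 - x * c) ^+ m.-1 * ((1 - x * c) * - phi t x)).
  have -> : (fun y => u x y ^+ m) =
      ((1 - x * c) *: (cst 1 - (phi t x *: id))) ^+ m.
    by apply/funext => y; rewrite exprfctE /u [y * _]mulrC.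
  apply: is_derive_eq.
  by rewrite !fctE /GRing.scale /= !(mulr0, subr0, mulr1, sub0r).
have dg : is_derive (0 : C) 1 (fun y => u y x ^+ m)
    (m%:R * (1 - x * c) ^+ m.-1 * (- (x * derive1 (phi t) 0) - (1 - x * c) * c)).
  have -> : (fun y => u y x ^+ m) =
      ((cst 1 - (c *: id)) * (cst 1 - (x *: phi t))) ^+ m.
    by apply/funext => y; rewrite exprfctE /u [y * _]mulrC.
  apply: is_derive_eq.
  rewrite !fctE /GRing.scale /= !(mulr0, subr0, mulr1, mul1r, sub0r) -/c.
  ring.
have := near_eq_is_derive fg df => df'.
have : m%:R * (1 - x * c) ^+ m.-1 * ((1 - x * c) * - phi t x) =
   m%:R * (1 - x * c) ^+ m.-1 * (- (x * derive1 (phi t) 0) - (1 - x * c) * c).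
  by rewrite -(@derive_val _ _ _ _ _ _ _ df') -(@derive_val _ _ _ _ _ _ _ dg).
(* Differentiating the powers replaces a choice of [m]-th roots by the cancellation of this common
   factor. *)
have k0 : m%:R * (1 - x * c) ^+ m.-1 != 0.
  by rewrite mulf_neq0 ?expf_neq0 // pnatr_eq0 addn_eq0 negb_and -lt0n gamma_ge1.
move=> /(mulfI k0) e; rewrite -/c.
apply: (mulfI cx); rewrite -[LHS]opprK -mulrN e; field.
exact: cx.
Qed.

(** Identifies the constant found in [psi_formula] with the normalised derivative of [psi] at 0. *)
Lemma mpartial_psi (a : C) :
  (forall x : Cd, polydisk x -> psi x =
    a * \prod_j (x ord0 j ^+ n j * (1 - x ord0 j * phi j 0) ^- (gamma + n j))) ->
  mpartial n psi 0 = a * \prod_(j < d) (n j)`!%:R.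
Proof.
move=> hpsi.
pose g (j : 'I_d) k z := rat_iter (phi j 0) (gamma + n j) 'X^(n j) k z.
have h0 : polydisk (0 : Cd) by move=> j; rewrite mxE; exact: disk0.
rewrite (mpartial_prod g _ a n psi _ _ h0); first last.
- move=> z hz; rewrite hpsi //; congr (_ * _); apply: eq_bigr => j _.
  by rewrite /g /rat_iter /= hornerXn addn0 [phi j 0 * _]mulrC.
- move=> j k z hz; apply: is_derive_rat_iter; rewrite mulrC.
  by apply: disk_subM_neq0 => //; apply: phi_disk; exact: disk0.
congr (_ * _); apply: eq_bigr => j _.
by rewrite /g /rat_iter mxE num_iter_Xn mulr0 subr0 expr1n divr1.
Qed.

End symbols.

Theorem theorem2p2 (R : realType) (gamma d : nat)
    (gamma_ge1 : (1 <= gamma)%N) (d_ge1 : (1 <= d)%N)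
    (n : 'I_d -> nat)
    (psi : 'rV[Cplx R]_d -> Cplx R)
    (psi_holo : holomorphic psi)
    (psi_neq0 : exists z, polydisk z /\ psi z != 0)
    (phi : 'I_d -> Cplx R -> Cplx R)
    (phi_holo : holomorphic (prod_map phi))
    (phi_self : forall z, polydisk z -> polydisk (prod_map phi z))
    (H : Hspace R d gamma)
    (D : {linear H -> H})
    (D_bounded : bounded_operator D)
    (D_def : realizes D (comp_diff n psi (prod_map phi))) :
  complex_symmetric (rk_dot H) (J H) D <->
  (* the Taylor coefficient of psi at 0; equal to [mpartial n psi 0] when all
     n j <= 1, and the factorials are needed otherwise *)
  let a := mpartial n psi 0 / \prod_(j < d) ((n j)`!)%:R in
  (forall z, polydisk z ->
     psi z = a * \prod_(j < d)
       (z ord0 j ^+ n j * (1 - z ord0 j * phi j 0) ^- (gamma + n j))) /\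
  (forall (t : 'I_d) (z : Cplx R), disk z ->
     phi t z = phi t 0 + (1 - z * phi t 0)^-1 * z * derive1 (phi t) 0).
Proof.
have [w [hw psiw]] := psi_neq0.
rewrite (symbol_symP _ _ _ gamma_ge1 phi_self _ _ D_bounded D_def); split.
  move=> psi_sym.
  have [c psiE] := psi_formula _ _ _ phi_self phi_holo psi_sym.
  (* A zero constant would make [psi] vanish on the whole polydisk; [phi_formula] cancels it. *)
  have c0 : c != 0 by apply: contraNneq psiw => c0; rewrite psiE // c0 mul0r.
  rewrite (mpartial_psi _ _ _ phi_self _ psiE) mulfK; last first.
    by apply/prodf_neq0 => j _; rewrite pnatr_eq0 -lt0n fact_gt0.
  split; first exact: psiE.
  exact: (phi_formula _ _ _ gamma_ge1 phi_self phi_holo _ c0 psiE psi_sym).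
move=> [psiE phiE].
exact: (symbol_sym_of_formulas _ _ _ phi_self _ _ psiE phiE).
Qed.
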